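(* A connected graph $G$ on more than three vertices is Cartesian-topfull if and only if it has no cut vertex.
   Context: Graphs are finite, simple and undirected; $d_G$ denotes shortest-path distance. A cut vertex of a connected graph $G$ is a vertex $v$ with $G-v$ disconnected. For an integer $\ell\ge0$, a weak walk of length $\ell$ on $G$ is a function $f:\{0,\dots,\ell\}\to V(G)$ with $f(i)=f(i+1)$ or $f(i)f(i+1)\in E(G)$ for all $0\le i<\ell$; a weak $\ell$-track is a surjective weak walk. For a family $F=\{f_1,\dots,f_p\}$ ($p\ge2$) of such functions, $m_G(F)=\min_{i\ne j}\min_t d_G(f_i(t),f_j(t))$. A family $F=\{f_1,\dots,f_p\}$ of weak walks of length $\ell$ is patient if for each $i\in\{0,\dots,\ell-1\}$ there is $j$ with $f_j(i)f_j(i+1)\in E(G)$ and $f_{j'}(i)=f_{j'}(i+1)$ for all $j'\ne j$; a patient $\ell$-tour is a patient family all of whose members are weak $\ell$-tracks. For a non-trivial connected $G$ that is not a path, the Cartesian $1$-capacity $\mathrm{cap}^\square_1(G)$ is the maximum $c$ such that there is a patient $\ell$-tour $F=\{f_1,\dots,f_c\}$ on $G$ (some $\ell$) with $m_G(F)=1$. A connected graph $G$ on $n$ vertices is Cartesian-topfull if $\mathrm{cap}^\square_1(G)=n-1$. *)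

(* Defs.v *)
From mathcomp Require Export all_boot.

Set Implicit Arguments.
Unset Strict Implicit.
Unset Printing Implicit Defensive.

(* A finite simple graph is an adjacency relation [e : rel T] on a finType,
   assumed symmetric and irreflexive where it is used. *)

Definition connected_graph (T : finType) (e : rel T) : Prop :=
  forall x y : T, connect e x y.

Definition del_vertex (T : finType) (e : rel T) (v : T) :
    rel {x : T | x != v} :=
  fun x y => e (val x) (val y).

Definition cut_vertex (T : finType) (e : rel T) (v : T) : Prop :=
  ~ connected_graph (@del_vertex T e v).

Definition path_of_length (T : finType) (e : rel T) (x y : T) (k : nat) : bool :=
  [exists p : k.-tuple T, path e x p && (last x p == y)].

(* The least length of an e-path from x to y.  A shortest path has length
   less than #|T|, so only those lengths are searched; the value is #|T| when
   x and y lie in different components. *)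
Definition dist (T : finType) (e : rel T) (x y : T) : nat :=
  find (path_of_length e x y) (iota 0 #|T|).

Lemma dist_connectP (T : finType) (e : rel T) (x y : T) : connect e x y ->
  exists2 p, path e x p & last x p = y /\ size p = dist e x y.
Proof.
move=> /connectP[p ep ->]; case/shortenP: ep => p' ep' up' _.
set y0 := last x p'.
have hp : has (path_of_length e x y0) (iota 0 #|T|).
  apply/hasP; exists (size p').
    rewrite mem_iota add0n /= -[(size p').+1]/(size (x :: p')).
    by rewrite -(card_uniqP up') max_card.
  by apply/existsP; exists (in_tuple p'); rewrite ep' eqxx.
have := nth_find 0 hp; rewrite nth_iota; last by move: hp; rewrite has_find size_iota.
rewrite add0n => /existsP[q /andP[eq /eqP lq]].
by exists q => //; split=> //; rewrite size_tuple.
Qed.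

Lemma dist_path (T : finType) (e : rel T) (x : T) (p : seq T) :
  path e x p -> dist e x (last x p) <= size p.
Proof.
move=> ep; rewrite leqNgt; apply/negP => lt.
have := before_find 0 lt; rewrite nth_iota; last first.
  by rewrite (leq_trans lt) // -[X in _ <= X](size_iota 0) find_size.
rewrite add0n => /existsP; apply.
by exists (in_tuple p); rewrite ep eqxx.
Qed.

Definition weak_walk (T : finType) (e : rel T) (l : nat) (f : 'I_l.+1 -> T) :
    Prop :=
  forall i i' : 'I_l.+1, i' = i.+1 :> nat -> f i = f i' \/ e (f i) (f i').

Definition weak_track (T : finType) (e : rel T) (l : nat) (f : 'I_l.+1 -> T) :
    Prop :=
  weak_walk e f /\ forall x : T, exists t, f t = x.

Definition patient (T : finType) (e : rel T) (p l : nat)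
    (F : 'I_p -> 'I_l.+1 -> T) : Prop :=
  (forall j, weak_walk e (F j)) /\
  forall i i' : 'I_l.+1, i' = i.+1 :> nat ->
    exists j, e (F j i) (F j i') /\ forall j', j' != j -> F j' i = F j' i'.

Definition patient_tour (T : finType) (e : rel T) (p l : nat)
    (F : 'I_p -> 'I_l.+1 -> T) : Prop :=
  patient e F /\ forall j, weak_track e (F j).

(* Since dist never exceeds #|T|, the default value #|T| of the iterated
   minimum does not affect it as soon as 2 <= p. *)
Definition min_dist (T : finType) (e : rel T) (p l : nat)
    (F : 'I_p -> 'I_l.+1 -> T) : nat :=
  \big[minn/#|T|]_(i < p) \big[minn/#|T|]_(j < p | i != j)
    \big[minn/#|T|]_(t < l.+1) dist e (F i t) (F j t).

Definition has_patient_1tour (T : finType) (e : rel T) (c : nat) : Prop :=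
  2 <= c /\
  exists (l : nat) (F : 'I_c -> 'I_l.+1 -> T),
    patient_tour e F /\ min_dist e F = 1.

(* "The Cartesian 1-capacity of the graph is c", a relation because a maximum
   need not exist: it holds of no c when the graph is a path. *)
Definition is_cartesian_capacity1 (T : finType) (e : rel T) (c : nat) : Prop :=
  has_patient_1tour e c /\ forall c', has_patient_1tour e c' -> c' <= c.

Definition cartesian_topfull (T : finType) (e : rel T) : Prop :=
  is_cartesian_capacity1 e #|T|.-1.

(* Main.v *)
Require Import Defs.
From mathcomp Require Import all_boot.

Set Implicit Arguments.
Unset Strict Implicit.
Unset Printing Implicit Defensive.

(** With n - 1 tokens on n vertices there is always exactly one free vertex, so
    a patient family is a play of the sliding-token puzzle.  If no vertex is a
    cut vertex, a token at x can be moved to any neighbour y: the free vertex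
    travels to y inside G - x, and then the token steps onto y; concatenating
    such moves yields a tour.  If v separates a set C from the rest, call a
    token bound to C when it lies in C, or lies at v while the free vertex is
    in C.  Being bound is invariant, so a bound token never visits the rest.
    Finally n tokens leave no room for any move, hence the capacity is at most
    n - 1. *)

Lemma bigminn_leq (I : finType) (P : pred I) (F : I -> nat) (d : nat) (i : I) :
  P i -> \big[minn/d]_(j | P j) F j <= F i.
Proof.
move=> Pi; have : i \in index_enum I by rewrite mem_index_enum.
elim: (index_enum I) => [//|j r IHr].
rewrite inE big_cons => /orP[/eqP <-|/IHr le_r]; first by rewrite Pi geq_minl.
by case: ifP => // _; rewrite geq_min le_r orbT.
Qed.

Lemma leq_bigminn (I : finType) (P : pred I) (F : I -> nat) (d m : nat) :
  m <= d -> (forall j, P j -> m <= F j) -> m <= \big[minn/d]_(j | P j) F j.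
Proof.
by move=> le_d le_F; apply: (big_ind (leq m)) => // a b; rewrite leq_min => -> ->.
Qed.

Section Distance.

Variables (T : finType) (e : rel T).

Lemma distxx (x : T) : dist e x x = 0.
Proof. by apply/eqP; rewrite -leqn0 (@dist_path T e x [::]). Qed.

Lemma dist_gt0 (x y : T) : connected_graph e -> x != y -> 0 < dist e x y.
Proof.
move=> e_conn xy; have [p _ [lp <-]] := dist_connectP (e_conn x y).
by case: p lp => //= eq_xy; rewrite eq_xy eqxx in xy.
Qed.

Lemma dist_edge (x y : T) : e x y -> dist e x y <= 1.
Proof. by move=> xy; apply: (@dist_path T e x [:: y]); rewrite /= xy. Qed.

Lemma min_dist_leq (p l : nat) (F : 'I_p -> 'I_l.+1 -> T) i j t :
  i != j -> min_dist e F <= dist e (F i t) (F j t).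
Proof.
move=> ij; rewrite /min_dist.
apply: leq_trans (bigminn_leq (P := xpredT) _ _ (i := i) _) _ => //.
apply: leq_trans (bigminn_leq (P := fun j => i != j) _ _ (i := j) _) _ => //.
exact: (bigminn_leq (P := xpredT)).
Qed.

Lemma min_dist_gt0_inj (p l : nat) (F : 'I_p -> 'I_l.+1 -> T) :
  0 < min_dist e F -> forall t, injective (F^~ t).
Proof.
move=> F_gt0 t i j eq_ij; apply/eqP/negPn/negP => /(min_dist_leq F t).
by rewrite eq_ij distxx leqNgt F_gt0.
Qed.

Lemma inj_min_dist_gt0 (p l : nat) (F : 'I_p -> 'I_l.+1 -> T) :
  connected_graph e -> 0 < #|T| -> (forall t, injective (F^~ t)) ->
  0 < min_dist e F.
Proof.
move=> e_conn T_gt0 F_inj; do 3![apply: leq_bigminn => // ? ?].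
by apply: dist_gt0 => //; rewrite (inj_eq (F_inj _)).
Qed.

End Distance.

Lemma free_vertex (T : finType) (g : 'I_#|T|.-1 -> T) :
  0 < #|T| -> injective g ->
  exists b, forall x, (x != b) = (x \in codom g).
Proof.
move=> T_gt0 g_inj.
have /card1P[b free] : #|[predC codom g]| == 1.
  by rewrite -(eqn_add2l #|codom g|) cardC card_codom // card_ord addn1 prednK.
exists b => x.
by have := free x; rewrite !inE => <-; rewrite negbK.
Qed.

Lemma occupied_vertex (T : finType) (g : 'I_#|T|.-1 -> T) (b x : T) :
  injective g -> (forall k, g k != b) -> x != b -> exists k, x = g k.
Proof.
move=> g_inj gb xb; apply/codomP.
have T_gt0 : 0 < #|T| by apply/card_gt0P; exists b.
have [b' b'_free] := free_vertex T_gt0 g_inj.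
suff bb' : b = b' by rewrite -b'_free -bb'.
apply/eqP/negPn; rewrite b'_free; apply/codomP => -[k bk].
by have := gb k; rewrite bk eqxx.
Qed.

Lemma free_vertex_uniq (T : finType) (g : 'I_#|T|.-1 -> T) (b b' : T) :
  injective g -> (forall k, g k != b) -> (forall k, g k != b') -> b = b'.
Proof.
move=> g_inj gb gb'; apply/eqP/negPn/negP => /(occupied_vertex g_inj gb')[k bk].
by have := gb k; rewrite bk eqxx.
Qed.

Section Separation.

Variables (T : finType) (e : rel T) (C : pred T) (v : T).
Hypotheses (e_sym : symmetric e) (e_irr : irreflexive e).
Hypotheses (vC : ~~ C v) (C_closed : forall x y, C x -> e x y -> y != v -> C y).

Lemma separated_tokens (l : nat) (F : 'I_#|T|.-1 -> 'I_l.+1 -> T) (c d : T) :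
  C c -> ~~ C d -> d != v -> patient e F -> (forall t, injective (F^~ t)) ->
  exists j, forall t, F j t != d.
Proof.
move=> Cc Cd dv [_ F_pat] F_inj.
have T_gt0 : 0 < #|T| by apply/card_gt0P; exists c.
pose bound j t := C (F j t) \/
  F j t = v /\ exists2 b, C b & forall k, F k t != b.
have [j bj0] : exists j, bound j ord0.
  have [b b_free] := free_vertex T_gt0 (F_inj ord0).
  have [Cb|Cb] := boolP (C b).
    have : v != b by apply: contraNneq vC => ->.
    rewrite b_free => /codomP[j vj]; exists j; right; split=> //.
    by exists b => // k; rewrite b_free (codom_f (F^~ ord0)).
  have : c != b by apply: contraNneq Cb => <-.
  by rewrite b_free => /codomP[j jc]; exists j; left; rewrite -jc.
exists j => t.
suff bj : bound j t.
  apply/eqP => Fd; case: bj => [|[]]; rewrite Fd ?(negPf Cd) // => dv'.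
  by rewrite dv' eqxx in dv.
have [m] := ubnP t; elim: m => // m IHm in t *.
case: t => -[|t] lt_t /=.
  by move=> _; rewrite (_ : Ordinal lt_t = ord0) //; apply: val_inj.
rewrite ltnS => lt_m.
have := IHm (Ordinal (ltnW lt_t)) lt_m.
set i := Ordinal (ltnW lt_t); set i' := Ordinal lt_t => bj.
have [k [ek k_stay]] := F_pat i i' erefl.
have neq_k : F k i != F k i' by apply: contraTneq ek => ->; rewrite e_irr.
have old_free k' : F k' i != F k i'.
  have [-> //|k'k] := eqVneq k' k.
  by rewrite (k_stay k' k'k) (inj_eq (F_inj i')).
have new_free k' : F k' i' != F k i.
  have [->|k'k] := eqVneq k' k; first by rewrite eq_sym.
  by rewrite -(k_stay k' k'k) (inj_eq (F_inj i)).
have [eq_jk|jk] := eqVneq j k.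
  rewrite -eq_jk in ek old_free new_free.
  case: bj => [Cj|[jv [b Cb b_free]]].
    have [jv|jv] := eqVneq (F j i') v; last by left; apply: C_closed ek jv.
    by right; split=> //; exists (F j i).
  by left; rewrite (free_vertex_uniq (F_inj i) old_free b_free).
rewrite /bound -(k_stay j jk); case: bj => [Cj|[jv [b Cb b_free]]]; first by left.
right; split=> //; exists (F k i) => //.
apply: (C_closed (x := F k i')).
- by rewrite (free_vertex_uniq (F_inj i) old_free b_free).
- by rewrite e_sym.
- by rewrite -jv (inj_eq (F_inj i)) eq_sym.
Qed.

End Separation.

Lemma cut_vertex_no_tour (T : finType) (e : rel T) (v : T) :
  symmetric e -> irreflexive e -> cut_vertex e v ->
  ~ has_patient_1tour e #|T|.-1.
Proof.
move=> e_sym e_irr v_cut [_ [l [F [[F_pat F_track] F_dist]]]].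
have F_inj : forall t, injective (F^~ t).
  by apply: (@min_dist_gt0_inj _ e); rewrite F_dist.
apply: v_cut => x y; apply/negPn/negP => not_xy.
pose C := [pred z | [exists u, (val u == z) && connect (@del_vertex T e v) x u]].
have C_sub u : C (val u) = connect (@del_vertex T e v) x u.
  by apply/existsP/idP => [[w /andP[/eqP/val_inj ->]]|xu] //; exists u; rewrite eqxx.
have vC : ~~ C v.
  by apply/existsP => -[u /andP[/eqP uv _]]; have := valP u; rewrite uv eqxx.
have C_closed a b : C a -> e a b -> b != v -> C b.
  move=> /existsP[u /andP[/eqP <- xu]] ub bv.
  rewrite -[b]/(val (exist (fun z => z != v) b bv)) C_sub.
  by apply: connect_trans xu _; apply: connect1.
have Cx : C (val x) by rewrite C_sub.
have Cy : ~~ C (val y) by rewrite C_sub.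
have [j jy] := separated_tokens e_sym e_irr vC C_closed Cx Cy (valP y) F_pat F_inj.
by have [t ty] := (F_track j).2 (val y); have := jy t; rewrite ty eqxx.
Qed.

Lemma patient_tour_leq (T : finType) (e : rel T) (c : nat) :
  irreflexive e -> 1 < #|T| -> has_patient_1tour e c -> c <= #|T|.-1.
Proof.
move=> e_irr T_gt1 [c_gt1 [l [F [[[_ F_pat] F_track] F_dist]]]].
have F_inj : forall t, injective (F^~ t).
  by apply: (@min_dist_gt0_inj _ e); rewrite F_dist.
have c_le := leq_card _ (F_inj ord0); rewrite card_ord in c_le.
rewrite -ltnS prednK ?(ltnW T_gt1) // ltn_neqAle c_le andbT.
apply/eqP => c_eq.
case: l F F_pat F_track F_dist F_inj {c_le} => [|l] F F_pat F_track F_dist F_inj.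
  have [x [y [_ _ /eqP[]]]] := card_gt1P T_gt1.
  have [t <-] := (F_track (Ordinal (ltnW c_gt1))).2 x.
  have [t' <-] := (F_track (Ordinal (ltnW c_gt1))).2 y.
  by rewrite [t]ord1 [t']ord1.
pose i' : 'I_l.+2 := lift ord0 ord0.
have [j [ej j_stay]] := F_pat ord0 i' erefl.
have : F j i' \in codom (F^~ ord0).
  by apply: inj_card_onto (F_inj ord0) _ _; rewrite card_ord c_eq.
case/codomP => k; have [->|kj] := eqVneq k j => jk.
  by rewrite -jk e_irr in ej.
by rewrite (j_stay k kj) in jk; move/F_inj: jk kj => ->; rewrite eqxx.
Qed.

Section Puzzle.

Variables (T : finType) (e : rel T).
Local Notation config := {ffun 'I_#|T|.-1 -> T}.

Definition step : rel config := fun g h =>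
  injectiveb h &&
  [exists j, e (g j) (h j) && [forall j', (j' != j) ==> (g j' == h j')]].

Lemma connect_step_inj (g h : config) :
  injective g -> connect step g h -> injective h.
Proof.
move=> g_inj /connectP[p + ->].
elim: p g g_inj => //= g' p IHp g _ /andP[/andP[/injectiveP g'_inj _]].
exact: IHp.
Qed.

Definition move (g : config) (j : 'I_#|T|.-1) (b : T) : config :=
  [ffun i => if i == j then b else g i].

Lemma move_step (g : config) j b :
  injective g -> (forall k, g k != b) -> e (g j) b -> step g (move g j b).
Proof.
move=> g_inj gb ejb; apply/andP; split.
  apply/injectiveP => i k; rewrite !ffunE.
  have [->|ij] := eqVneq i j; have [->|kj] := eqVneq k j => //.
  - by move=> bk; have := gb k; rewrite bk eqxx.
  - by move=> bi; have := gb i; rewrite bi eqxx.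
  - exact: g_inj.
apply/existsP; exists j; rewrite ffunE eqxx ejb /=.
by apply/forallP => k; apply/implyP => kj; rewrite ffunE (negPf kj).
Qed.

Hypotheses (e_sym : symmetric e) (e_irr : irreflexive e).

Lemma move_free_vertex (x : T) (u w : {z : T | z != x}) (g : config) j :
  connect (@del_vertex T e x) u w -> injective g -> g j = x ->
  (forall k, g k != val u) ->
  exists h, [/\ connect step g h, h j = x & forall k, h k != val w].
Proof.
move=> /connectP[p + ->] + + +.
elim: p u g => [|u' p IHp] u g /=; first by exists g.
move=> /andP[uu' u'p] g_inj jx gu.
have u'u : val u' != val u.
  by apply: contraTneq uu' => uu'; rewrite /del_vertex uu' e_irr.
have [k ku'] := occupied_vertex g_inj gu u'u.
have gg' : step g (move g k (val u)).
  by apply: move_step => //; rewrite -ku' e_sym.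
have g'_inj := connect_step_inj g_inj (connect1 gg').
have jk : j != k.
  by apply: contraTneq (valP u') => jk; rewrite ku' -jk jx eqxx.
case: (IHp u' _ u'p g'_inj) => [|i|h [g'h hj hw]].
- by rewrite ffunE (negPf jk).
- rewrite ffunE; have [_|ik] := eqVneq i k; last by rewrite ku' (inj_eq g_inj).
  by rewrite eq_sym.
- by exists h; split=> //; apply: connect_trans g'h; apply: connect1.
Qed.

Hypotheses (e_conn : connected_graph e).
Hypothesis no_cut : forall v, connected_graph (@del_vertex T e v).

Lemma move_token (g : config) j (y : T) : injective g ->
  exists2 h, connect step g h & h j = y.
Proof.
have T_gt0 : 0 < #|T| by apply/card_gt0P; exists y.
move=> g_inj; have /connectP[p gp y_last] := e_conn (g j) y.
elim: p g g_inj gp y_last => [|z p IHp] g g_inj /=; first by exists g.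
move=> /andP[gz zp] y_last.
have zj : z != g j by apply: contraTneq gz => ->; rewrite e_irr.
have [b b_free] := free_vertex T_gt0 g_inj.
have gb k : g k != b by rewrite b_free codom_f.
have bj : b != g j by rewrite eq_sym.
have [h [gh hj hz]] := move_free_vertex (no_cut
  (exist (fun z => z != g j) b bj) (exist (fun z => z != g j) z zj))
  g_inj erefl gb.
have h_inj := connect_step_inj g_inj gh.
have hh' : step h (move h j z) by apply: move_step => //; rewrite hj.
have h'_inj := connect_step_inj h_inj (connect1 hh').
case: (IHp _ h'_inj) => [||h2 h'h2 h2j]; rewrite ?ffunE ?eqxx //.
by exists h2 => //; apply: connect_trans gh (connect_trans (connect1 hh') h'h2).
Qed.

Lemma step_tour (s : seq ('I_#|T|.-1 * T)) (g : config) : injective g ->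
  exists2 p, path step g p &
    forall jx, jx \in s -> exists2 h : config, h \in g :: p & h jx.1 = jx.2.
Proof.
elim: s g => [|[j x] s IHs] g g_inj; first by exists [::].
have [h gh hj] := move_token j x g_inj.
have /IHs[q hq q_s] := connect_step_inj g_inj gh.
have [p gp h_last] := connectP gh; exists (p ++ q).
  by rewrite cat_path gp -h_last.
move=> jx; rewrite inE => /orP[/eqP -> | /q_s[h' h'q h'j]].
  by exists h => //; rewrite -cat_cons mem_cat h_last mem_last.
exists h' => //; move: h'q; rewrite -cat_cons mem_cat !inE => /orP[/eqP ->|->].
  by rewrite -in_cons h_last mem_last.
by rewrite orbT.
Qed.

Lemma no_cut_vertex_tour : 3 < #|T| -> has_patient_1tour e #|T|.-1.
Proof.
move=> T_gt3; have T_gt0 : 0 < #|T| by apply: leq_trans T_gt3.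
have m_gt1 : 1 < #|T|.-1 by rewrite -ltnS prednK // ltnW.
split=> //.
pose g : config := [ffun i => enum_val (widen_ord (leq_pred #|T|) i)].
have g_inj : injective g.
  by move=> i j; rewrite !ffunE => /enum_val_inj/(congr1 val) /= ij; apply: val_inj.
have [p gp p_tour] := step_tour (enum {: 'I_#|T|.-1 * T}) g_inj.
exists (size p), (fun j t => nth g (g :: p) t j).
have F_step (i i' : 'I_(size p).+1) : i' = i.+1 :> nat ->
    step (nth g (g :: p) i) (nth g (g :: p) i').
  move=> ii'; rewrite ii' /=; apply: (pathP g gp).
  by have := ltn_ord i'; rewrite ii' ltnS.
have F_inj (t : 'I_(size p).+1) : injective (nth g (g :: p) t).
  case: t => -[|t] lt_t //=.
  by have /andP[/injectiveP] := F_step (Ordinal (ltnW lt_t)) (Ordinal lt_t) erefl.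
have F_patient (i i' : 'I_(size p).+1) : i' = i.+1 :> nat -> exists j,
    e (nth g (g :: p) i j) (nth g (g :: p) i' j) /\
    forall j', j' != j -> nth g (g :: p) i j' = nth g (g :: p) i' j'.
  move=> /F_step/andP[_ /existsP[j /andP[ej /forallP stay]]].
  by exists j; split=> // k kj; apply/eqP; have := stay k; rewrite kj.
have F_walk j : weak_walk e (fun t : 'I_(size p).+1 => nth g (g :: p) t j).
  move=> i i' /F_patient[k [ek stay]].
  by have [->|/stay] := eqVneq j k; [right | left].
split.
  split=> //.
  move=> j; split=> // x.
  have [|h hp hj] := p_tour (j, x); first by rewrite mem_enum.
  have lt_h : index h (g :: p) < (size p).+1.
    by rewrite -[(size p).+1]/(size (g :: p)) index_mem.
  by exists (Ordinal lt_h); rewrite /= -[X in _ = X]hj nth_index.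
apply/eqP; rewrite eqn_leq inj_min_dist_gt0 // andbT.
have [b b_free] := free_vertex T_gt0 g_inj.
have gb k : g k != b by rewrite b_free codom_f.
pose i0 : 'I_#|T|.-1 := Ordinal (ltnW m_gt1).
pose i1 : 'I_#|T|.-1 := Ordinal m_gt1.
have [k ek] : exists k, e (g i0) (g k).
  have /connectP[[|z q] /=] := no_cut (exist (fun z => z != b) (g i0) (gb i0))
    (exist (fun z => z != b) (g i1) (gb i1)).
    by move=> _ [/g_inj].
  move=> /andP[ez _] _; have [k zk] := occupied_vertex g_inj gb (valP z).
  by exists k; rewrite -zk.
have i0k : i0 != k by apply: contraTneq ek => ->; rewrite e_irr.
exact: leq_trans (@min_dist_leq T e _ _ _ _ _ ord0 i0k) (dist_edge ek).
Qed.

End Puzzle.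

Theorem theorem3p29 (T : finType) (e : rel T)
    (e_sym : symmetric e) (e_irr : irreflexive e)
    (e_conn : connected_graph e) (T_gt3 : 3 < #|T|) :
  cartesian_topfull e <-> ~ (exists v : T, cut_vertex e v).
Proof.
split=> [[tour _] [v v_cut]|no_cut].
  exact: cut_vertex_no_tour v_cut tour.
split; last by move=> c; apply: patient_tour_leq => //; apply: leq_trans T_gt3.
apply: no_cut_vertex_tour => // v x y.
by apply/negPn/negP => xy; apply: no_cut; exists v => /(_ x y); apply/negP.
Qed.
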